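(* For each base $2\le b\le 10$, the complete list of fixed points and cycles of the $b$-elated function $E_{2,b}:\mathbb{Z}^+\to\mathbb{Z}^+$ under iteration is the following, where all numbers are written in base $b$, a one-element tuple $(c)$ denotes a fixed point, and a tuple $(c_1,\dots,c_\ell)$ denotes the cycle $c_1\mapsto c_2\mapsto\cdots\mapsto c_\ell\mapsto c_1$ under $E_{2,b}$: \begin{itemize} \item $b=2$: $(1)$. \item $b=3$: $(1)$, $(12)$, $(20,22,121)$. \item $b=4$: $(1)$, $(20)$. \item $b=5$: $(1)$, $(13,20)$. \item $b=6$: $(1)$, $(50,325,310)$, $(53,442,400,144)$. \item $b=7$: $(1)$, $(13)$, $(22)$, $(505)$, $(2,11)$. \item $b=8$: $(1)$, $(536)$, $(660)$, $(36,207,152)$, $(5,175,113,13,12)$. \item $b=9$: $(1)$, $(30)$, $(646)$, $(762)$. \item $b=10$: $(1)$, $(298)$, $(46,208,136)$, $(26,80,512,150)$, $(33,54,205,58,445,228,144)$. \end{itemize}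
   Context: For a base $b\ge 2$, every $a\in\mathbb{Z}^+$ has a base $b$ expansion $a=\sum_{i=0}^n a_ib^i$ with $0\le a_i<b$ and leading digit $a_n\ne 0$. The $b$-elated function $E_{2,b}:\mathbb{Z}^+\to\mathbb{Z}^+$ is defined by $E_{2,b}(a)=a_n\sum_{i=0}^n a_i^2$. *)

(* Defs.v *)
From mathcomp Require Import all_boot.
From Corelib Require Import Decimal.
From Corelib Require Number.

Set Implicit Arguments.
Unset Strict Implicit.
Unset Printing Implicit Defensive.

(* For 1 < b and 0 < a, the leading base-b digit of a has index trunc_log b a;
   agreement with an arbitrary base-b expansion is lemma elatedE. *)
Definition digit (b a i : nat) : nat := a %/ b ^ i %% b.

Definition elated (b a : nat) : nat :=
  let n := trunc_log b a in
  digit b a n * \sum_(i < n.+1) digit b a i ^ 2.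

Lemma expansion_recl b n (d : nat -> nat) :
  \sum_(j < n.+2) d j * b ^ j = (\sum_(j < n.+1) d j.+1 * b ^ j) * b + d 0.
Proof.
rewrite big_ord_recl /= expn0 muln1 addnC; congr (_ + _).
by rewrite big_distrl /=; apply: eq_bigr => j _; rewrite expnSr mulnA.
Qed.

Lemma digit_expansion b n (d : nat -> nat) i : 1 < b ->
  (forall j, j <= n -> d j < b) -> i <= n ->
  digit b (\sum_(j < n.+1) d j * b ^ j) i = d i.
Proof.
move=> b_gt1; have b_gt0 := ltnW b_gt1.
elim: n d i => [|n IHn] d i d_lt le_in.
  move: le_in; rewrite leqn0 => /eqP->.
  by rewrite big_ord1 /digit expn0 muln1 divn1 modn_small // d_lt.
rewrite expansion_recl; case: i le_in => [_|i le_in].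
  by rewrite /digit expn0 divn1 modnMDl modn_small ?d_lt.
rewrite /digit expnS divnMA divnMDl // (divn_small (d_lt 0 _)) // addn0.
by apply: (IHn (fun j => d j.+1)) => // j le_jn; apply: d_lt.
Qed.

Lemma expansion_lt b n (d : nat -> nat) : 1 < b ->
  (forall j, j <= n -> d j < b) -> \sum_(j < n.+1) d j * b ^ j < b ^ n.+1.
Proof.
move=> b_gt1; elim: n => [|n IHn] d_lt.
  by rewrite big_ord1 expn0 muln1 expn1 d_lt.
rewrite big_ord_recr /=.
apply: (@leq_trans (b ^ n.+1 + d n.+1 * b ^ n.+1)).
  by rewrite ltn_add2r IHn // => j le_jn; apply/d_lt/leqW.
by rewrite -mulSn [b ^ n.+2]expnS leq_mul2r d_lt ?orbT.
Qed.

Lemma elatedE b n (d : nat -> nat) : 1 < b ->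
  (forall i, i <= n -> d i < b) -> d n != 0 ->
  elated b (\sum_(i < n.+1) d i * b ^ i) = d n * \sum_(i < n.+1) d i ^ 2.
Proof.
move=> b_gt1 d_lt dn_neq0; rewrite /elated.
have -> : trunc_log b (\sum_(i < n.+1) d i * b ^ i) = n.
  apply: trunc_log_eq => //; rewrite expansion_lt // andbT big_ord_recr /=.
  by apply: leq_trans (leq_addl _ _); rewrite leq_pmull // lt0n.
rewrite digit_expansion //; congr (_ * _).
by apply: eq_bigr => i _; rewrite digit_expansion // -ltnS.
Qed.

Lemma elated_gt0 b a : 1 < b -> 0 < a -> 0 < elated b a.
Proof.
move=> b_gt1 a_gt0; rewrite /elated; set n := trunc_log b a.
have /andP[le_a lt_a] := trunc_log_bounds b_gt1 a_gt0.
have d_gt0 : 0 < digit b a n.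
  rewrite /digit modn_small ?divn_gt0 ?expn_gt0 ?(ltnW b_gt1) //.
  by rewrite ltn_divLR ?expn_gt0 ?(ltnW b_gt1) // -expnS.
by rewrite muln_gt0 d_gt0 big_ord_recr addn_gt0 expn_gt0 d_gt0 orbT.
Qed.

(* [:: c_1; ...; c_l] stands for c_1 |-> ... |-> c_l |-> c_1; l = 1 is a fixed
   point. *)
Definition is_cycle (f : nat -> nat) (s : seq nat) : bool :=
  [&& s != [::], all (leq 1) s, uniq s & fcycle f s].

Declare Scope numeral_scope.
Delimit Scope numeral_scope with numeral.
Definition numeral_of_literal (u : Number.uint) : option uint :=
  if u is Number.UIntDecimal v then Some v else None.
Number Notation uint numeral_of_literal Number.UIntDecimal : numeral_scope.

(* 121%numeral is the string of digits D1 (D2 (D1 Nil)), most significant digit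
   first; it has no value until it is read in some base b. *)
Fixpoint read_digits (b acc : nat) (u : uint) : nat :=
  match u with
  | Nil => acc
  | D0 v => read_digits b (acc * b) v
  | D1 v => read_digits b (acc * b + 1) v
  | D2 v => read_digits b (acc * b + 2) v
  | D3 v => read_digits b (acc * b + 3) v
  | D4 v => read_digits b (acc * b + 4) v
  | D5 v => read_digits b (acc * b + 5) v
  | D6 v => read_digits b (acc * b + 6) v
  | D7 v => read_digits b (acc * b + 7) v
  | D8 v => read_digits b (acc * b + 8) v
  | D9 v => read_digits b (acc * b + 9) v
  end.

Definition in_base (b : nat) (u : uint) : nat := read_digits b 0 u.

(* Two sequences describe the same cycle exactly when they are rotations of
   each other. *)
Definition complete_cycle_list (b : nat) (L : seq (seq uint)) : Prop :=
  forall s : seq nat, is_cycle (elated b) s <->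
    exists2 t, t \in map (map (in_base b)) L & exists k, s = rot k t.

(* Main.v *)
Require Import Defs.
From mathcomp Require Import all_boot.
From mathcomp Require Import zify.

Set Implicit Arguments.
Unset Strict Implicit.
Unset Printing Implicit Defensive.

(** Once [a] has four digits or more, its leading digit [c] satisfies
    [c * b ^ n <= a], where [n >= 3] is its position, whereas the elated function
    multiplies [c] by a sum of squares of digits that is smaller than [b ^ n]. So
    the function decreases strictly on [b ^ 3, oo) ([elated_lt]), and the least
    element [m] of any cycle lies below [b ^ 3].

    This leaves finitely many candidates for [m]. No iterate of [m] is below [m],
    since the iterates stay in the cycle; so if every positive [m < b ^ 3] has an
    iterate that either is below [m] or belongs to a listed cycle, then every
    cycle meets a listed one, and two cycles of a function with a common point are
    rotations of each other ([common_point_rot]). That is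
    [cycle_classification], which turns the completeness of a list of cycles into
    a finite check; for each base the check is carried out by computation through
    [cycle_certificateP]. *)

(** * Decrease of the elated function on large numbers *)

(** The bound on [n] cannot be lowered uniformly in [b]: at [n = 2] the
    inequality reads [3 * (b - 1) ^ 2 < b ^ 2], which fails from [b = 3] on. *)
Lemma digit_sum_bound b n : 1 < b -> 2 < n -> n.+1 * b.-1 ^ 2 < b ^ n.
Proof.
case: b => [|[|c]] // _; elim: n => // n IHn; rewrite ltnS leq_eqVlt.
case/orP => [/eqP<- {IHn} /=|/IHn {}IHn]; first by rewrite !expnS !expn0; nia.
apply: (@leq_ltn_trans (2 * (n.+1 * c.+2.-1 ^ 2))).
  by rewrite mulnA leq_mul2r; apply/orP; right; lia.
by apply: (@leq_trans (2 * c.+2 ^ n)); rewrite ?ltn_pmul2l // expnS leq_mul2r orbT.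
Qed.

(** Both [a] and its image contain the leading digit as a factor, up to rounding
    for [a]; cancelling it leaves the comparison of [b ^ n] with the sum of the
    squares of the [n + 1] digits. *)
Lemma elated_lt b a : 1 < b -> b ^ 3 <= a -> elated b a < a.
Proof.
move=> b_gt1 le_b3a; have b_gt0 := ltnW b_gt1.
have a_gt0 : 0 < a by apply: leq_trans le_b3a; rewrite expn_gt0 b_gt0.
rewrite /elated; set n := trunc_log b a.
have n_gt2 : 2 < n by rewrite -[3](trunc_expnK 3 b_gt1) leq_trunc_log.
have /andP[le_bna lt_abn] := trunc_log_bounds b_gt1 a_gt0.
have bn_gt0 : 0 < b ^ n by rewrite expn_gt0 b_gt0.
have -> : digit b a n = a %/ b ^ n.
  by rewrite /digit modn_small // ltn_divLR // -expnS.
apply: leq_trans (leq_divM a (b ^ n)).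
rewrite ltn_pmul2l ?divn_gt0 //.
apply: leq_ltn_trans (digit_sum_bound b_gt1 n_gt2).
rewrite -[X in X * _]card_ord -sum_nat_const; apply: leq_sum => i _.
by rewrite leq_exp2r // -ltnS prednK // ltn_pmod.
Qed.

(** * Cycles with a common point *)

Lemma fcycle_closed (T : eqType) (f : T -> T) s x k :
  fcycle f s -> x \in s -> iter k f x \in s.
Proof.
move=> cyc_s s_x; elim: k => //= k IHk.
by rewrite (eqP (next_cycle cyc_s IHk)) mem_next.
Qed.

Lemma fcycle_traject (T : eqType) (f : T -> T) x p :
  fcycle f (x :: p) ->
  x :: p = traject f x (size p).+1 /\ iter (size p).+1 f x = x.
Proof.
rewrite /= rcons_path => /andP[/fpathE def_p /eqP last_p].
by split; rewrite /= -?def_p // -{2}last_p def_p last_traject size_traject.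
Qed.

(** A cycle through [x] shorter than [x :: q] would bring [x] back inside [q]
    before its end, against uniqueness. *)
Lemma fcycle_head_leq (T : eqType) (f : T -> T) x p q :
  fcycle f (x :: p) -> fcycle f (x :: q) -> uniq (x :: q) -> size q <= size p.
Proof.
move=> /fcycle_traject[_ per_p] /fcycle_traject[def_q _] uniq_q.
rewrite leqNgt; apply: contraL uniq_q => lt_pq.
rewrite def_q trajectS /= -{1}per_p iterSr; apply/nandP; left; rewrite negbK.
by apply/trajectP; exists (size p).
Qed.

(** Rotated so as to start at [x], both cycles are the trajectory of [x] up to its
    first return, hence equal; it remains to undo the rotation of [s]. *)
Lemma common_point_rot (T : eqType) (f : T -> T) s t x :
  fcycle f s -> uniq s -> fcycle f t -> uniq t -> x \in s -> x \in t ->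
  exists k, s = rot k t.
Proof.
move=> cyc_s uniq_s cyc_t uniq_t /rot_to[i p def_p] /rot_to[j q def_q].
have cyc_p : fcycle f (x :: p) by rewrite -def_p rot_cycle.
have cyc_q : fcycle f (x :: q) by rewrite -def_q rot_cycle.
have uniq_p : uniq (x :: p) by rewrite -def_p rot_uniq.
have uniq_q : uniq (x :: q) by rewrite -def_q rot_uniq.
have eq_size : size p = size q.
  by apply/eqP; rewrite eqn_leq !(@fcycle_head_leq _ f x).
have eq_rot : rot i s = rot j t.
  have [def_p' _] := fcycle_traject cyc_p.
  have [def_q' _] := fcycle_traject cyc_q.
  by rewrite def_p def_q def_p' eq_size -def_q'.
(* Two rotations compose into one through [rot_add_mod], which asks for amounts
   that do not exceed the size. *)
have le_mn n (u : seq T) : exists2 m, m <= size u & rot n u = rot m u.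
  case: (leqP n (size u)) => [|/ltnW] le_nu; first by exists n.
  by exists 0; rewrite // rot0 rot_oversize.
have -> : s = rotr i (rot j t) by rewrite -eq_rot rotK.
rewrite /rotr; have [m le_m ->] := le_mn j t.
have [l le_l ->] := le_mn (size (rot m t) - i) (rot m t).
rewrite size_rot in le_l; rewrite rot_add_mod //; by eexists.
Qed.

(** * Reduction to a finite check *)

Lemma is_cycle_rot f k s : is_cycle f (rot k s) = is_cycle f s.
Proof.
by rewrite /is_cycle (perm_all _ (permEl (perm_rot k s))) rot_uniq rot_cycle -!size_eq0 size_rot.
Qed.

(** The candidate [m] stands for the least element of a cycle. Asking only for an
    iterate below [m] would not do for numbers that reach a listed cycle lying
    entirely above them. *)
Lemma cycle_classification (f : nat -> nat) B (L : seq (seq nat)) :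
  (forall a, B <= a -> f a < a) ->
  all (is_cycle f) L ->
  (forall m, 0 < m < B ->
     exists k, (iter k f m < m) || (iter k f m \in flatten L)) ->
  forall s, is_cycle f s <-> exists2 t, t \in L & exists k, s = rot k t.
Proof.
move=> decr_f cycL minL s; split=> [cyc_s | [t L_t [k ->]]]; last first.
  by rewrite is_cycle_rot (allP cycL).
have /and4P[s_neq0 s_gt0 uniq_s fcyc_s] := cyc_s.
have ex_s : exists m, m \in s.
  by case: (s) s_neq0 => // x p _; exists x; rewrite mem_head.
have [m s_m min_m] := ex_minnP ex_s.
have le_iter k : m <= iter k f m by apply/min_m/fcycle_closed.
have m_bounds : 0 < m < B.
  rewrite (allP s_gt0) //= ltnNge.
  by apply/negP => /decr_f; rewrite ltnNge (le_iter 1).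
have [k] := minL m m_bounds.
rewrite ltnNge le_iter /= => /flattenP[t L_t t_fkm].
exists t => //; have /and4P[_ _ uniq_t fcyc_t] := allP cycL t L_t.
exact: common_point_rot fcyc_s uniq_s fcyc_t uniq_t (fcycle_closed k fcyc_s s_m) t_fkm.
Qed.

(** * Evaluation *)

(** The big operators are locked, so that [elated] does not reduce on numerals;
    this form does. *)
Definition elated_eval b a :=
  let n := trunc_log b a in
  digit b a n * sumn [seq digit b a i ^ 2 | i <- iota 0 n.+1].

Lemma elated_evalE b : elated b =1 elated_eval b.
Proof.
move=> a; rewrite /elated /elated_eval sumnE big_map.
by rewrite -(big_mkord xpredT (fun i => digit b a i ^ 2)) /index_iota subn0.
Qed.

(** The conditional in place of a disjunction stops the iteration as soon as [P]
    holds, even under call-by-value evaluation. *)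
Fixpoint orbit_meets (f : nat -> nat) (P : pred nat) k x : bool :=
  if P x then true else
  if k is k'.+1 then orbit_meets f P k' (f x) else false.

Lemma orbit_meetsP f P k x : orbit_meets f P k x -> exists j, P (iter j f x).
Proof.
elim: k x => [|k IHk] x /=; (case: ifP => [Px _|_]; first by exists 0) => //.
by case/IHk=> j; rewrite -iterSr; exists j.+1.
Qed.

Definition cycle_certificate b k L :=
  all (is_cycle (elated_eval b)) L &&
  all (fun m => orbit_meets (elated_eval b)
                  (fun y => if y < m then true else y \in flatten L) k m)
      (iota 1 (b ^ 3).-1).

Lemma cycle_certificateP b k L : 1 < b ->
  cycle_certificate b k [seq map (in_base b) t | t <- L] ->
  complete_cycle_list b L.
Proof.
move=> b_gt1 /andP[cycL minL] s.
have eq_cyc : is_cycle (elated b) =1 is_cycle (elated_eval b).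
  move=> t; rewrite /is_cycle (eq_cycle (e' := frel (elated_eval b))) //.
  by move=> x y; rewrite /= elated_evalE.
apply: (cycle_classification (B := b ^ 3)) => [a|| m m_bounds].
- exact: elated_lt.
- by rewrite (eq_all eq_cyc).
have b3_gt0 : 0 < b ^ 3 by rewrite expn_gt0 ltnW.
have /(allP minL) : m \in iota 1 (b ^ 3).-1 by rewrite mem_iota add1n prednK.
case/orbit_meetsP=> j stop_j; exists j.
by rewrite (eq_iter (elated_evalE b)).
Qed.

Theorem theorem5 :
  complete_cycle_list 2 [:: [:: 1]]%numeral /\
  complete_cycle_list 3 [:: [:: 1]; [:: 12]; [:: 20; 22; 121]]%numeral /\
  complete_cycle_list 4 [:: [:: 1]; [:: 20]]%numeral /\
  complete_cycle_list 5 [:: [:: 1]; [:: 13; 20]]%numeral /\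
  complete_cycle_list 6
    [:: [:: 1]; [:: 50; 325; 310]; [:: 53; 442; 400; 144]]%numeral /\
  complete_cycle_list 7
    [:: [:: 1]; [:: 13]; [:: 22]; [:: 505]; [:: 2; 11]]%numeral /\
  complete_cycle_list 8
    [:: [:: 1]; [:: 536]; [:: 660]; [:: 36; 207; 152];
        [:: 5; 175; 113; 13; 12]]%numeral /\
  complete_cycle_list 9 [:: [:: 1]; [:: 30]; [:: 646]; [:: 762]]%numeral /\
  complete_cycle_list 10
    [:: [:: 1]; [:: 298]; [:: 46; 208; 136]; [:: 26; 80; 512; 150];
        [:: 33; 54; 205; 58; 445; 228; 144]]%numeral.
Proof.
(* The longest search occurs in base 9, where 33 (36 in that base) takes 22 steps to
   succeed. *)
do 8 (split; first by apply: (@cycle_certificateP _ 22); [|vm_compute]).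
by apply: (@cycle_certificateP _ 22); [|vm_compute].
Qed.
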